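(* Let $H$ be a hypergraph, let $U_1,\ldots,U_n$ be pairwise disjoint subsets of $V(H)$, and let $c_1,\ldots,c_n\in\mathbb{C}$. Then $\sum_{i=1}^n c_i|e\cap U_i|=0$ for every hyperedge $e\in E(H)$ if and only if $B_H\left(\sum_{i=1}^n c_i\chi_{U_i}\right)=0$.
   Context: A hypergraph $H$ is a pair $(V(H),E(H))$ with $V(H)$ a non-empty finite set (vertices) and $E(H)$ a set of non-empty subsets of $V(H)$ (hyperedges). The edge-vertex incidence matrix $B_H=[b_{ev}]_{e\in E(H),v\in V(H)}$ has $b_{ev}=1$ if $v\in e$ and $b_{ev}=0$ otherwise; for a vector $x:V(H)\to\mathbb{C}$, $(B_Hx)(e)=\sum_{v\in e}x(v)$. For $U\subseteq V(H)$, $\chi_U:V(H)\to\{0,1\}$ is the characteristic function of $U$. *)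

(* Defs.v *)
From HB Require Import structures.
From mathcomp Require Import all_boot all_order all_algebra.
From mathcomp Require Import complex reals.

Set Implicit Arguments.
Unset Strict Implicit.
Unset Printing Implicit Defensive.

Import GRing.Theory Num.Theory.
Local Open Scope ring_scope.

Record hypergraph := Hypergraph {
  vertex : finType;
  edges : {set {set vertex}};
  vertex_nonempty : (0 < #|vertex|)%N;
  edges_nonempty : set0 \notin edges
}.

(* MathComp matrices are indexed by ordinals: the row index i stands for the
   hyperedge enum_val i and the column index j for the vertex enum_val j.
   Vectors V(H) -> C are column vectors, indexed in the same way. *)
Definition incidence (K : pzSemiRingType) (H : hypergraph) :
    'M[K]_(#|edges H|, #|vertex H|) :=
  \matrix_(i, j) ((enum_val j : vertex H) \in (enum_val i : {set vertex H}))%:R.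

Definition charvec (K : pzSemiRingType) (H : hypergraph) (U : {set vertex H}) :
    'cV[K]_#|vertex H| :=
  \col_j ((enum_val j : vertex H) \in U)%:R.

(* Main.v *)
Require Import Defs.
From HB Require Import structures.
From mathcomp Require Import all_boot all_order all_algebra.
From mathcomp Require Import complex reals.

Set Implicit Arguments.
Unset Strict Implicit.
Unset Printing Implicit Defensive.

Import GRing.Theory Num.Theory.
Local Open Scope ring_scope.

(** The entry of [B_H chi_U] at a hyperedge [e] counts the vertices of [e] that
    lie in [U]. By linearity, the entry of [B_H (sum_i c_i chi_(U_i))] at [e] is
    then [sum_i c_i #|e :&: U_i|], so the two conditions of the theorem are the
    same system of equations, one for each hyperedge. *)

(** The product of the indicators of [v \in e] and [v \in U] is the indicator
    of [v \in e :&: U]. *)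
Lemma incidence_charvecE (K : pzSemiRingType) (H : hypergraph)
    (U : {set vertex H}) (k : 'I_#|edges H|) (j : 'I_1) :
  (incidence K H *m charvec K U) k j = #|enum_val k :&: U|%:R.
Proof.
have -> : #|enum_val k :&: U| = (\sum_v (v \in enum_val k :&: U))%N.
  by rewrite -sum1_card big_mkcond; apply: eq_bigr => v _; case: (v \in _).
rewrite natr_sum mxE [RHS](reindex (@enum_val _ (vertex H))); last first.
  exact/onW_bij/enum_val_bij.
by apply: eq_bigr => v _; rewrite !mxE -natrM mulnb inE.
Qed.

Lemma incidence_sum_charvecE (K : comPzRingType) (H : hypergraph) (n : nat)
    (U : 'I_n -> {set vertex H}) (c : 'I_n -> K)
    (k : 'I_#|edges H|) (j : 'I_1) :
  (incidence K H *m (\sum_(i < n) c i *: charvec K (U i))) k j =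
  \sum_(i < n) c i * #|enum_val k :&: U i|%:R.
Proof.
rewrite mulmx_sumr summxE; apply: eq_bigr => i _.
by rewrite -scalemxAr mxE incidence_charvecE.
Qed.

Theorem theorem2p19 (R : realType) (H : hypergraph) (n : nat)
    (U : 'I_n -> {set vertex H}) (c : 'I_n -> R[i])
    (disjU : forall i j : 'I_n, i != j -> [disjoint U i & U j]) :
  (forall e : {set vertex H}, e \in edges H ->
     \sum_(i < n) c i * #|e :&: U i|%:R = 0)
  <->
  incidence R[i] H *m (\sum_(i < n) c i *: charvec R[i] (U i)) = 0.
Proof.
split=> [sum0 | Bx0 e eH].
  apply/matrixP=> k j; rewrite incidence_sum_charvecE mxE.
  exact: sum0 (enum_valP k).
rewrite -(enum_rankK_in eH eH) -(incidence_sum_charvecE U c _ ord0) Bx0.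
by rewrite mxE.
Qed.
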